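(* Let $\omega,\xi,\eta$ be elements of $\mathbb{F}_{q^2}$ satisfying $\omega^{q+1}=-1$, $\xi^{q+1}=1$ with $\xi^2\neq-1$, and $\eta^{q+1}=\xi^q+\xi$ (so $\eta\ne0$). Then the curve $$C_{F_J}=\left\{{}^{t}\!\left(\eta^{-q}\xi^q s^{q+1}-\eta^{-q}t^{q+1},\ s^qt,\ st^q,\ \omega\eta^{-1}\xi s^{q+1}+\omega\eta^{-1}t^{q+1}\right)\in\mathbb{P}^3 \ \middle|\ {}^{t}(s,t)\in\mathbb{P}^1\right\}$$ is a smooth nonplanar rational curve of degree $q+1$ contained in the Fermat surface $X_I$.
   Context: Let $p$ be a prime, $q$ a power of $p$, and $k$ an algebraic closure of $\mathbb{F}_q$. Points of the projective space $\mathbb{P}^3$ over $k$ are written as column vectors. For a matrix $m$ over $k$, $m^{(q)}$ denotes the matrix whose entries are the $q$-th powers of those of $m$. The Fermat surface is $X_I=\{x\in\mathbb{P}^3 : {}^{t}x\,x^{(q)}=0\}$, i.e. $x_0^{q+1}+x_1^{q+1}+x_2^{q+1}+x_3^{q+1}=0$. For a positive integer $d$ and a $4\times(d+1)$ matrix $F$ over $k$ with $\mathrm{rank}(F)\ge 2$, the rational curve $C_F$ of degree $d$ is the image of the rational map $\mathbb{P}^1\to\mathbb{P}^3$, ${}^{t}(s,t)\mapsto F\,{}^{t}(s^d,s^{d-1}t,\dots,st^{d-1},t^d)$. It is called nonplanar if $\mathrm{rank}(F)=4$, i.e. it is not contained in any plane. *)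

(* Defs.v *)
From mathcomp Require Import all_boot all_order all_algebra.
From mathcomp Require Import mpoly.

Set Implicit Arguments.
Unset Strict Implicit.
Unset Printing Implicit Defensive.

Import GRing.Theory.
Local Open Scope ring_scope.

(* A point of P^3 is a line through the origin of k^4. *)
Definition P3 (k : fieldType) : Type :=
  {L : {vspace 'cV[k]_4} | \dim L == 1%N}.

(* As P has dimension 1, the equation below forces x != 0. *)
Definition hcoord (k : fieldType) (P : P3 k) (x : 'cV[k]_4) : Prop :=
  val P = <[x]>%VS.

Definition frob_mx (k : fieldType) (q m n : nat) (A : 'M[k]_(m, n)) :
  'M[k]_(m, n) := map_mx (fun a => a ^+ q) A.

Definition fermat_surface (k : fieldType) (q : nat) (P : P3 k) : Prop :=
  exists2 x, hcoord P x & x^T *m frob_mx q x = 0.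

Definition veronese (k : fieldType) (d : nat) (s t : k) : 'cV[k]_d.+1 :=
  \col_(j < d.+1) (s ^+ (d - j) * t ^+ j).

(* The curve C_F.  Parameters (s : t) at which F *m veronese d s t vanishes
   give no point, since hcoord excludes the zero vector. *)
Definition rational_curve (k : fieldType) (d : nat) (F : 'M[k]_(4, d.+1))
    (P : P3 k) : Prop :=
  exists s t : k, (s, t) != (0, 0) /\ hcoord P (F *m veronese d s t).

Definition nonplanar (k : fieldType) (d : nat) (F : 'M[k]_(4, d.+1)) : Prop :=
  \rank F = 4%N.

Definition meval_col (k : fieldType) (f : {mpoly k[4]}) (x : 'cV[k]_4) : k :=
  f.@[fun i => x i 0].

(* The homogeneous elements of the ideal I(C) of a subset C of P^3; they
   generate I(C). *)
Definition vanishing_form (k : fieldType) (C : P3 k -> Prop)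
    (f : {mpoly k[4]}) : Prop :=
  (exists m : nat, f \is m.-homog) /\
  (forall P x, C P -> hcoord P x -> meval_col f x = 0).

Definition zariski_closed (k : fieldType) (C : P3 k -> Prop) : Prop :=
  forall P, (forall f x, vanishing_form C f -> hcoord P x ->
    meval_col f x = 0) -> C P.

(* v lies in the linear subspace of k^4 whose projectivization is the embedded
   tangent space of C at the point with homogeneous coordinates x. *)
Definition tangent (k : fieldType) (C : P3 k -> Prop) (x v : 'cV[k]_4) : Prop :=
  forall f, vanishing_form C f ->
    \sum_(i < 4) meval_col f^`M(i) x * v i 0 = 0.

(* Smoothness of the reduced subvariety C of P^3, for C of pure dimension 1:
   every embedded tangent space is a projective line (Jacobian criterion with
   respect to the full ideal of C). *)
Definition smooth_curve (k : fieldType) (C : P3 k -> Prop) : Prop :=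
  zariski_closed C /\
  forall P x, C P -> hcoord P x ->
    exists2 T : {vspace 'cV[k]_4}, \dim T = 2%N &
      forall v, v \in T <-> tangent C x v.

(* Degree of a curve in P^3: the number of its intersection points with the
   plane h *m x = 0, for every h outside the zero locus of some nonzero
   polynomial G on the space of linear forms. *)
Definition curve_degree (k : fieldType) (C : P3 k -> Prop) (d : nat) : Prop :=
  exists2 G : {mpoly k[4]}, G != 0 &
    forall h : 'rV[k]_4, meval_col G h^T != 0 ->
      exists S : seq (P3 k),
        [/\ uniq S, size S = d &
            forall P, P \in S <->
              (C P /\ exists2 x, hcoord P x & h *m x = 0)].

(* The subfield of k with q^2 elements. *)
Definition in_Fq2 (k : fieldType) (q : nat) (x : k) : Prop :=
  x ^+ (q ^ 2) = x.

Definition col4 (k : fieldType) (a b c d : k) : 'cV[k]_4 :=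
  \col_(i < 4) [:: a; b; c; d]`_i.

Definition paramJ (k : fieldType) (q : nat) (omega xi eta s t : k) :
    'cV[k]_4 :=
  col4 (eta ^- q * xi ^+ q * s ^+ q.+1 - eta ^- q * t ^+ q.+1)
       (s ^+ q * t)
       (s * t ^+ q)
       (omega * eta^-1 * xi * s ^+ q.+1 + omega * eta^-1 * t ^+ q.+1).

Definition curveJ (k : fieldType) (q : nat) (omega xi eta : k) (P : P3 k) :
    Prop :=
  exists s t : k, (s, t) != (0, 0) /\ hcoord P (paramJ q omega xi eta s t).

(* The coefficient matrix of paramJ; its nonzero columns are those of the
   monomials s^(q+1), s^q t, s t^q, t^(q+1), of indices 0, 1, q, q+1. *)
Definition FJ (k : fieldType) (q : nat) (omega xi eta : k) :
    'M[k]_(4, q.+2) :=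
  \matrix_(i < 4, j < q.+2)
    (if j == 0%N :> nat then
       col4 (eta ^- q * xi ^+ q) 0 0 (omega * eta^-1 * xi) i 0
     else if j == 1%N :> nat then col4 0 1 0 0 i 0
     else if j == q :> nat then col4 0 0 1 0 i 0
     else if j == q.+1 :> nat then
       col4 (- eta ^- q) 0 0 (omega * eta^-1) i 0
     else 0).

(* Main.v *)
Require Import Defs.
From mathcomp Require Import all_boot all_order all_algebra all_field.
From mathcomp Require Import mpoly.
From mathcomp Require Import ring.

Set Implicit Arguments.
Unset Strict Implicit.
Unset Printing Implicit Defensive.

Import GRing.Theory.
Local Open Scope ring_scope.

(** The coordinates of [C] differ from
    [(X, Y, Z, W) = (s^(q+1), s^q t, s t^q, t^(q+1))] by a linear change of
    variables, invertible because [eta^(q+1) = xi^q + xi <> 0]; so closedness,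
    smoothness and degree need only be proved for this monomial curve.  It is
    the zero set of forms such as [Y Y^q - W X^q], whose differentials see only
    the factors that are not [q]-th powers; the four forms used cut the tangent
    space at [(s : t)] down to the span of [(s^q, 0, t^q, 0)] and
    [(0, s^q, 0, t^q)], which are the partial derivatives of the
    parametrization.  A plane meets the curve in the zeros of
    [u_0 s^(q+1) + u_1 s^q t + u_2 s t^q + u_3 t^(q+1)], which are simple as
    soon as [u_0 u_3 - u_1 u_2 <> 0]. *)

(** * Composition and differentiation of multivariate polynomials *)

Lemma mpoly_ring_ind (R : comNzRingType) (n : nat) (P : {mpoly R[n]} -> Prop) :
  (forall c, P c%:MP) -> (forall i, P 'X_i) ->
  (forall f g, P f -> P g -> P (f + g)) ->
  (forall f g, P f -> P g -> P (f * g)) -> forall f, P f.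
Proof.
move=> PC PX PD PM; elim/mpolyind => [|c m f _ _ Pf]; first exact: (PC 0).
apply: (PD _ _ _ Pf); rewrite -mul_mpolyC; apply: (PM) => //.
rewrite mpolyXE_id; elim/big_rec: _ => [|i g _ Pg]; first exact: (PC 1).
apply: (PM) => //; elim: (m i) => [|d IHd]; first exact: (PC 1).
by rewrite exprS; apply: (PM).
Qed.

(** [mmap polyC phi f] is [f] composed with the polynomial curve [phi]; both sides are ring
    morphisms in [f]. *)
Lemma horner_mmap_polyC (R : comNzRingType) (n : nat) (phi : 'I_n -> {poly R})
    (f : {mpoly R[n]}) (s : R) :
  (mmap polyC phi f).[s] = f.@[fun i => (phi i).[s]].
Proof.
elim/mpoly_ring_ind: f => [c|i|f g IHf IHg|f g IHf IHg].
- by rewrite mmapC mevalC hornerC.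
- by rewrite mmapX mmap1U mevalXU.
- by rewrite !rmorphD hornerD IHf IHg.
- by rewrite !rmorphM hornerM IHf IHg.
Qed.

Lemma mderivXU (R : nzRingType) (n : nat) (i j : 'I_n) :
  ('X_i : {mpoly R[n]})^`M(j) = (i == j)%:R.
Proof.
rewrite mderivX mnmE; case: eqP => [->|_]; last by rewrite scale0r.
by rewrite scale1r -[X in (X - _)%MM]add0m addmK mpolyX0.
Qed.

(** The chain rule along the curve [phi], checked on constants and variables. *)
Lemma deriv_mmap_polyC (R : comNzRingType) (n : nat) (phi : 'I_n -> {poly R})
    (f : {mpoly R[n]}) :
  (mmap polyC phi f)^`() = \sum_i mmap polyC phi f^`M(i) * (phi i)^`().
Proof.
elim/mpoly_ring_ind: f => [c|i|f g IHf IHg|f g IHf IHg].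
- rewrite mmapC derivC big1 // => i _.
  by rewrite mderivC rmorph0 mul0r.
- rewrite mmapX mmap1U (bigD1 i) //= big1 => [|j ji]; last first.
    by rewrite mderivXU eq_sym (negPf ji) rmorph0 mul0r.
  by rewrite mderivXU eqxx rmorph1 mul1r addr0.
- rewrite !rmorphD derivD IHf IHg -big_split; apply: eq_bigr => i _ /=.
  by rewrite mderivD rmorphD mulrDl.
- rewrite !rmorphM derivM IHf IHg mulr_suml mulr_sumr -big_split.
  by apply: eq_bigr => i _ /=; rewrite mderivM rmorphD !rmorphM; ring.
Qed.

Lemma poly_eq0_all_roots (k : closedFieldType) (f : {poly k}) :
  (forall x, f.[x] = 0) -> f = 0.
Proof.
move=> f0; apply/eqP; apply: contraT => /closed_nonrootP [x].
by rewrite /root f0 eqxx.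
Qed.

Lemma mderivX_pchar (R : comNzRingType) (n q : nat) (f : {mpoly R[n]})
    (i : 'I_n) : q%:R = 0 :> R -> (f ^+ q)^`M(i) = 0.
Proof.
move=> q0; have D d : (f ^+ d)^`M(i) = (f ^+ d.-1 * f^`M(i)) *+ d.
  elim: d => [|d IHd]; first by rewrite expr0 mderivC mulr0n.
  rewrite exprS mderivM IHd /= mulrnAr mulrA mulrSr -mulrC addrC.
  by case: d {IHd} => [|d]; rewrite ?mulr0n // -exprS.
by rewrite D -scaler_nat q0 scale0r.
Qed.

Lemma sum_ord4 (V : nmodType) (F : 'I_4 -> V) :
  \sum_(i < 4) F i = F 0 + F 1 + F 2 + F 3.
Proof.
rewrite !big_ord_recr big_ord0 /= add0r.
by congr (F _ + F _ + F _ + F _); apply: val_inj.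
Qed.

Lemma col4P (R : nzRingType) (x y : 'cV[R]_4) :
  [/\ x 0 0 = y 0 0, x 1 0 = y 1 0, x 2 0 = y 2 0 & x 3 0 = y 3 0] -> x = y.
Proof.
case=> e0 e1 e2 e3; apply/colP; case=> [[|[|[|[]]]] // lti].
- by have -> : Ordinal lti = 0 by apply: val_inj.
- by have -> : Ordinal lti = 1 by apply: val_inj.
- by have -> : Ordinal lti = 2 by apply: val_inj.
- by have -> : Ordinal lti = 3 by apply: val_inj.
Qed.

Lemma col2P (R : nzRingType) (x y : 'cV[R]_2) :
  x 0 0 = y 0 0 /\ x 1 0 = y 1 0 -> x = y.
Proof.
case=> e0 e1; apply/colP; case=> [[|[|[]]] // lti].
- by have -> : Ordinal lti = 0 by apply: val_inj.
- by have -> : Ordinal lti = 1 by apply: val_inj.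
Qed.

(** * The monomial curve and its linear images *)

Section FrobeniusCurve.

Variables (k : closedFieldType) (q : nat).

(** The ring is arbitrary so that the parameters may be polynomials when the curve is
    differentiated. *)
Definition frob_mono (R : comNzRingType) (s t : R) : 'cV[R]_4 :=
  \col_(i < 4) [:: s ^+ q.+1; s ^+ q * t; s * t ^+ q; t ^+ q.+1]`_i.

Definition frob_curve (A : 'M[k]_4) (P : P3 k) : Prop :=
  exists s t : k, (s, t) != (0, 0) /\ hcoord P (A *m frob_mono s t).

Lemma frob_mono_eq0 (s t : k) : (frob_mono s t == 0) = ((s, t) == (0, 0)).
Proof.
apply/eqP/eqP => [/colP e | [-> ->]]; last first.
  by apply: col4P; rewrite !mxE /= !exprS !mul0r mulr0.
have /= := e 0; rewrite !mxE /= => /eqP; rewrite expf_eq0 /= => /eqP ->.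
have /= := e 3; rewrite !mxE /= => /eqP; rewrite expf_eq0 /= => /eqP ->.
by [].
Qed.

Lemma frob_mono_scale (c s t : k) :
  frob_mono (c * s) (c * t) = c ^+ q.+1 *: frob_mono s t.
Proof. by apply: col4P; rewrite !mxE /= !exprMn !exprS; split; ring. Qed.

Lemma exists_root (n : nat) (c : k) : exists d : k, d ^+ n.+1 = c.
Proof.
have /closed_rootP [d] : size ('X^(n.+1) - c%:P : {poly k}) != 1%N.
  by rewrite size_XnsubC.
by rewrite /root !hornerE subr_eq0 => /eqP; exists d.
Qed.

Lemma hcoord_neq0 (P : P3 k) x : hcoord P x -> x != 0.
Proof.
case: P => L dL; rewrite /hcoord /= => e.
by move: dL; rewrite e dim_vline; case: (x != 0).
Qed.

Lemma hcoord_scale (P : P3 k) x c : c != 0 -> hcoord P x -> hcoord P (c *: x).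
Proof.
move=> c0; rewrite /hcoord => ->; apply/eqP; rewrite eqEsubv -!memvE.
apply/andP; split; last by rewrite memvZ ?memv_line.
by rewrite -[x in x \in _](scalerK c0) memvZ ?memv_line.
Qed.

Lemma hcoord_prop (P : P3 k) x y :
  hcoord P x -> hcoord P y -> exists2 c, c != 0 & y = c *: x.
Proof.
move=> Px Py; have /vlineP [c yE] : y \in <[x]>%VS by rewrite -Px Py memv_line.
exists c => //; apply: contraNneq (hcoord_neq0 Py) => c0.
by rewrite yE c0 scale0r.
Qed.

Lemma hcoord_ex (x : 'cV[k]_4) : x != 0 -> {P : P3 k | hcoord P x}.
Proof.
move=> x0; have d : \dim <[x]>%VS == 1%N by rewrite dim_vline x0.
by exists (exist (fun L => \dim L == 1%N) _ d).
Qed.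

Lemma hcoord_inj (P Q : P3 k) x : hcoord P x -> hcoord Q x -> P = Q.
Proof. by rewrite /hcoord => Px Qx; apply: val_inj; rewrite /= Px. Qed.

(** A point determines its coordinates up to a scalar [c]; a [q.+1]-th root of [c] moves that scalar
    into the parameters. *)
Lemma frob_curve_hcoord A P x : frob_curve A P -> hcoord P x ->
  exists s t, (s, t) != (0, 0) /\ x = A *m frob_mono s t.
Proof.
case=> s [t [st0 Pst]] Px; have [c c0 ->] := hcoord_prop Pst Px.
have [d dE] := exists_root q c; exists (d * s), (d * t); split.
  have d0 : d != 0 by apply: contraNneq c0 => d0; rewrite -dE d0 expr0n.
  move: st0; rewrite -!frob_mono_eq0 frob_mono_scale scaler_eq0 dE.
  by rewrite (negPf c0).
by rewrite frob_mono_scale dE scalemxAr.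
Qed.

(** * Forms vanishing on the curve, and closedness *)

Definition lin_form (B : 'M[k]_4) (a : 'I_4) : {mpoly k[4]} :=
  \sum_(j < 4) B a j *: 'X_j.

Definition frob_form (B : 'M[k]_4) (a b c d : 'I_4) : {mpoly k[4]} :=
  lin_form B a * lin_form B b ^+ q - lin_form B c * lin_form B d ^+ q.

Lemma meval_lin_form B a (x : 'cV[k]_4) :
  (lin_form B a).@[fun i => x i 0] = (B *m x) a 0.
Proof.
rewrite rmorph_sum /= mxE; apply: eq_bigr => j _.
by rewrite mevalZ mevalXU.
Qed.

Lemma mderiv_lin_form B a i : (lin_form B a)^`M(i) = (B a i)%:MP.
Proof.
rewrite linear_sum /= (bigD1 i) //= big1 => [|j ji].
  by rewrite linearZ /= mderivXU eqxx addr0 -mul_mpolyC mulr1.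
by rewrite linearZ /= mderivXU (negPf ji) scaler0.
Qed.

Lemma meval_frob_form B a b c d (x : 'cV[k]_4) (y := B *m x) :
  meval_col (frob_form B a b c d) x =
    y a 0 * y b 0 ^+ q - y c 0 * y d 0 ^+ q.
Proof.
by rewrite /meval_col !rmorphB !rmorphM !rmorphXn /= !meval_lin_form.
Qed.

Lemma frob_form_homog B a b c d : frob_form B a b c d \is q.+1.-homog.
Proof.
have L1 i : lin_form B i \is 1.-homog.
  by apply: rpred_sum => j _; apply: rpredZ; rewrite dhomogX /= mdeg1.
have Lq i : lin_form B i ^+ q \is q.-homog.
  by have := dhomogMn q (L1 i); rewrite mul1n.
by apply: rpredB; rewrite -[q.+1]add1n; apply: dhomogM.
Qed.

(* As [q = 0] in [k], the factors that are [q]-th powers have zero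
   differential. *)
Lemma differential_frob_form B a b c d (x v : 'cV[k]_4)
    (y := B *m x) (w := B *m v) :
  q%:R = 0 :> k ->
  \sum_(i < 4) meval_col (frob_form B a b c d)^`M(i) x * v i 0 =
    w a 0 * y b 0 ^+ q - w c 0 * y d 0 ^+ q.
Proof.
move=> q0; rewrite ![w _ _]mxE !mulr_suml -sumrB; apply: eq_bigr => i _.
rewrite /frob_form mderivB !mderivM !mderivX_pchar // !mulr0 !addr0.
rewrite !mderiv_lin_form /meval_col rmorphB !rmorphM !rmorphXn /=.
by rewrite !mevalC !meval_lin_form -/y; ring.
Qed.

Variable A : 'M[k]_4.
Hypothesis A_unit : A \in unitmx.
Local Notation B := (invmx A).

Lemma vanishing_frob_form (a b c d : 'I_4) :
  (forall s t : k, let y := frob_mono s t in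
     y a 0 * y b 0 ^+ q = y c 0 * y d 0 ^+ q) ->
  vanishing_form (frob_curve A) (frob_form B a b c d).
Proof.
move=> rel; split=> [|P x CP Px].
  by exists q.+1; apply: frob_form_homog.
have [s [t [_ ->]]] := frob_curve_hcoord CP Px.
by rewrite meval_frob_form mulKmx // rel subrr.
Qed.

(** In the coordinates [(X, Y, Z, W)] these are [Y^(q+1) - W X^q], [Z^(q+1) - X W^q],
    [X Y^q - Z X^q] and [Y W^q - W Z^q]. The first three cut out the curve. The first and third
    determine the tangent space where [s <> 0], the other two where [t <> 0]. *)
Lemma vanishing_forms :
  [/\ vanishing_form (frob_curve A) (frob_form B 1 1 3 0),
      vanishing_form (frob_curve A) (frob_form B 2 2 0 3),
      vanishing_form (frob_curve A) (frob_form B 0 1 2 0)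
    & vanishing_form (frob_curve A) (frob_form B 1 3 3 2)].
Proof.
split; apply: vanishing_frob_form => s t /=; rewrite !mxE /= !exprS !exprMn;
  ring.
Qed.

Lemma frob_curve_closed : (0 < q)%N -> zariski_closed (frob_curve A).
Proof.
move=> q_gt0 P Pvan; have [V1 V2 V3 _] := vanishing_forms.
have [x Px] : exists x, hcoord P x.
  case: P {Pvan} => L dL; exists (vpick L); apply/eqP.
  by rewrite eq_sym eqEdim -memvE memv_pick dim_vline vpick0 -dimv_eq0 (eqP dL).
pose y := B *m x; have xE : x = A *m y by rewrite mulKVmx.
have D a b c d : vanishing_form (frob_curve A) (frob_form B a b c d) ->
    y a 0 * y b 0 ^+ q = y c 0 * y d 0 ^+ q.
  move=> V; apply/eqP; have := Pvan _ _ V Px.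
  by rewrite meval_frob_form => /eqP; rewrite subr_eq0.
move: {D} (D _ _ _ _ V1) (D _ _ _ _ V2) (D _ _ _ _ V3) => E1 E2 E3.
clearbody y; have y_neq0 : y != 0.
  by apply: contraNneq (hcoord_neq0 Px) => y0; rewrite xE y0 mulmx0.
(* If [X = 0], the first two forms force [Y = Z = 0], which leaves the point with parameter
   [(0 : 1)]. *)
have [y0|y0] := eqVneq (y 0 0) 0.
  have y1 : y 1 0 = 0.
    apply/eqP; move/eqP: E1.
    by rewrite y0 expr0n eqn0Ngt q_gt0 mulr0 -exprS expf_eq0.
  have y2 : y 2 0 = 0.
    by apply/eqP; move/eqP: E2; rewrite y0 mul0r -exprS expf_eq0.
  have y3 : y 3 0 != 0.
    by apply: contraNneq y_neq0 => y3; apply/eqP/col4P; rewrite !mxE.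
  exists 0, 1; split; first by rewrite xpair_eqE oner_eq0 andbF.
  have -> : A *m frob_mono 0 1 = (y 3 0)^-1 *: x.
    rewrite xE scalemxAr; congr (_ *m _); apply: col4P.
    rewrite !mxE /= y0 y1 y2 !expr0n (gtn_eqF q_gt0) /= !mul0r !mulr0 expr1n.
    by rewrite mulVf.
  by apply: hcoord_scale => //; rewrite invr_eq0.
(* If [X <> 0], the parameter is [(1 : Y / X)]; the third form recovers [Z] and the first one
   [W]. *)
exists 1, (y 1 0 / y 0 0); split; first by rewrite xpair_eqE oner_eq0.
have -> : A *m frob_mono 1 (y 1 0 / y 0 0) = (y 0 0)^-1 *: x.
  rewrite xE scalemxAr; congr (_ *m _); apply: col4P.
  rewrite !mxE /= !expr1n !mul1r exprS expr_div_n.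
  have Y0 : y 0 0 ^+ q != 0 by rewrite expf_neq0.
  split; rewrite ?mulVf //; first by rewrite mulrC.
    by apply: (mulfI y0); apply: (mulIf Y0); field : E3; apply/andP.
  by apply: (mulfI y0); apply: (mulIf Y0); field : E1; apply/andP.
by apply: hcoord_scale => //; rewrite invr_eq0.
Qed.

(** * Tangent spaces and smoothness *)

(* In characteristic dividing [q], the two partial derivatives of
   [frob_mono] at [(s, t)] are the columns of this matrix. *)
Definition frob_tangent (s t : k) : 'M[k]_(4, 2) :=
  \matrix_(i < 4, j < 2)
    (nth [::] [:: [:: s ^+ q; 0]; [:: 0; s ^+ q];
                  [:: t ^+ q; 0]; [:: 0; t ^+ q]] i)`_j.

Lemma frob_tangentE s t w : frob_tangent s t *m w =
  col4 (s ^+ q * w 0 0) (s ^+ q * w 1 0) (t ^+ q * w 0 0) (t ^+ q * w 1 0).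
Proof.
apply: col4P; rewrite !mxE !big_ord_recl !big_ord0 !mxE /=.
have -> : lift ord0 ord0 = 1 :> 'I_2 by apply: val_inj.
by rewrite !mul0r !addr0 ?add0r.
Qed.

Hypothesis q_eq0 : q%:R = 0 :> k.

Lemma vanishing_form_frob f s t : vanishing_form (frob_curve A) f ->
  (s, t) != (0, 0) -> meval_col f (A *m frob_mono s t) = 0.
Proof.
move=> [_ fC] st0; have [|P Px] := @hcoord_ex (A *m frob_mono s t).
  apply: contraNneq st0 => /(congr1 (mulmx B)).
  by rewrite mulKmx // mulmx0 => /eqP; rewrite frob_mono_eq0.
by apply: (fC P) => //; exists s, t.
Qed.

Lemma deriv_exp_eq0 (u : {poly k}) : (u ^+ q)^`() = 0.
Proof. by rewrite deriv_exp -scaler_nat q_eq0 scale0r. Qed.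

(** The factors [u ^+ q] and [v ^+ q] behave as constants, so only the remaining linear factor of
    each monomial is differentiated. *)
Lemma deriv_frob_mono (u v : {poly k}) (a : k) :
  \col_j (frob_mono u v j 0)^`().[a] =
  frob_tangent u.[a] v.[a] *m \col_(i < 2) [:: u^`().[a]; v^`().[a]]`_i.
Proof.
rewrite frob_tangentE; apply: col4P; rewrite !mxE /=.
by rewrite !exprS !derivM !deriv_exp_eq0 !hornerE; split; ring.
Qed.

(* The form is restricted to the image of the line [(s + w_0 'X, t + w_1 'X)],
   where it vanishes identically, and differentiated at [0]. *)
Lemma frob_tangent_sub s t w : (s, t) != (0, 0) ->
  tangent (frob_curve A) (A *m frob_mono s t) (A *m (frob_tangent s t *m w)).
Proof.
move=> st0 f fC.
pose u := s%:P + w 0 0 *: 'X; pose v := t%:P + w 1 0 *: 'X.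
pose phi i := (map_mx polyC A *m frob_mono u v) i 0.
have phiE x : (fun i => (phi i).[x]) =1
    (fun i => (A *m frob_mono u.[x] v.[x]) i 0).
  move=> i; rewrite /phi !mxE horner_sum; apply: eq_bigr => j _.
  rewrite !mxE hornerM hornerC; congr (_ * _).
  by case: j => [[|[|[|[]]]] //= _]; rewrite !hornerE.
have u0 : u.[0] = s by rewrite !hornerE.
have v0 : v.[0] = t by rewrite !hornerE.
have gE x : (mmap polyC phi f).[x] = meval_col f (A *m frob_mono u.[x] v.[x]).
  by rewrite horner_mmap_polyC; apply: meval_eq; apply: phiE.
have g0 : mmap polyC phi f = 0.
  (* [l] is whichever of [u], [v] is nonzero at 0. It vanishes wherever both do, so its product with
     the restricted form has every element of [k] as a root and is therefore zero. *)
  have [l l0 lg] : exists2 l : {poly k}, l != 0 &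
      forall x, l.[x] != 0 -> (u.[x], v.[x]) != (0, 0).
    move: st0; rewrite xpair_eqE negb_and => /orP [s0 | t0].
      exists u => [|x ux]; last by rewrite xpair_eqE negb_and ux.
      by apply: contraNneq s0 => uE; rewrite -u0 uE horner0.
    exists v => [|x ux]; last by rewrite xpair_eqE negb_and ux orbT.
    by apply: contraNneq t0 => vE; rewrite -v0 vE horner0.
  apply/eqP; have /eqP : l * mmap polyC phi f = 0.
    apply: poly_eq0_all_roots => x; rewrite hornerM.
    have [->|lx] := eqVneq l.[x] 0; first by rewrite mul0r.
    by rewrite gE vanishing_form_frob ?mulr0 ?lg.
  by rewrite mulf_eq0 (negPf l0).
have := deriv_mmap_polyC phi f; rewrite g0 deriv0 => /(congr1 (horner^~ 0)).
rewrite horner0 horner_sum => dg0.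
rewrite [RHS]dg0; apply: eq_bigr => i _.
rewrite hornerM horner_mmap_polyC; congr (_ * _).
  by rewrite -u0 -v0; apply: meval_eq => j; rewrite phiE.
(* What remains is the velocity at 0 of the parametrized curve, where [u] and [v] have derivatives
   [w 0 0] and [w 1 0]. *)
rewrite mxE /phi [in RHS]mxE raddf_sum horner_sum; apply: eq_bigr => j _.
rewrite [map_mx _ _ _ _]mxE /= derivM derivC mul0r add0r hornerM hornerC.
congr (_ * _).
have /colP/(_ j) := deriv_frob_mono u v 0; rewrite mxE u0 v0 => ->.
congr ((_ *m _) _ _); apply: col2P; rewrite !mxE /=.
by split; rewrite derivD derivC derivZ derivX !hornerE.
Qed.

(** On [y = B v] the four differentials reduce to [y_0 t^q = y_2 s^q] and [y_1 t^q = y_3 s^q],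
    equations of the column space of [frob_tangent s t]. *)
Lemma tangent_sub_frob s t v : (s, t) != (0, 0) ->
  tangent (frob_curve A) (A *m frob_mono s t) v ->
  exists w, v = A *m (frob_tangent s t *m w).
Proof.
move=> st0 Tv; have [V1 V2 V3 V4] := vanishing_forms.
pose y := B *m v; have vE : v = A *m y by rewrite mulKVmx.
have D a b c d : vanishing_form (frob_curve A) (frob_form B a b c d) ->
    let m := frob_mono s t in
    y a 0 * m b 0 ^+ q - y c 0 * m d 0 ^+ q = 0.
  by move/Tv; rewrite differential_frob_form // mulKmx.
move: {D} (D _ _ _ _ V1) (D _ _ _ _ V2) (D _ _ _ _ V3) (D _ _ _ _ V4).
clearbody y; rewrite /= ![frob_mono _ _ _ _]mxE /= => E1 E2 E3 E4.
have [r1 r2] : y 0 0 * t ^+ q = y 2 0 * s ^+ q /\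
               y 1 0 * t ^+ q = y 3 0 * s ^+ q.
  (* Up to sign, [E3] and [E1] are these relations times [s^(q^2)], while [E2] and [E4] are these
     relations times [t^(q^2)]. *)
  move: st0; rewrite xpair_eqE negb_and => /orP [] /(expf_neq0 q) nz.
    have nz' := expf_neq0 q nz; split; apply: (mulIf nz').
      by apply/eqP; rewrite -subr_eq0 -E3 !exprS !exprMn; apply/eqP; ring.
    by apply/eqP; rewrite -subr_eq0 -E1 !exprS !exprMn; apply/eqP; ring.
  have nz' := expf_neq0 q nz; split; apply: (mulIf nz').
    by apply/esym/eqP; rewrite -subr_eq0 -E2 !exprS !exprMn; apply/eqP; ring.
  by apply/eqP; rewrite -subr_eq0 -E4 !exprS !exprMn; apply/eqP; ring.
move: st0; rewrite xpair_eqE negb_and => /orP [] /(expf_neq0 q) nz.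
  exists (\col_(i < 2) [:: y 0 0 / s ^+ q; y 1 0 / s ^+ q]`_i).
  rewrite vE frob_tangentE; congr (_ *m _); apply: col4P; rewrite !mxE /=.
  by split; apply: (mulIf nz); rewrite -?r1 -?r2; field.
exists (\col_(i < 2) [:: y 2 0 / t ^+ q; y 3 0 / t ^+ q]`_i).
rewrite vE frob_tangentE; congr (_ *m _); apply: col4P; rewrite !mxE /=.
by split; apply: (mulIf nz); rewrite ?r1 ?r2; field.
Qed.

Lemma frob_curve_smooth : (0 < q)%N -> smooth_curve (frob_curve A).
Proof.
move=> q_gt0; split=> [|P x CP Px]; first exact: frob_curve_closed.
have [s [t [st0 ->]]] := frob_curve_hcoord CP Px.
pose f : 'Hom('cV[k]_2, 'cV[k]_4) := linfun (mulmx (A *m frob_tangent s t)).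
exists (f @: fullv)%VS => [|v].
  (* The dimension is 2 by injectivity: one of [s^q], [t^q] is nonzero, and the two rows of
     [frob_tangent s t] containing it recover [w]. *)
  rewrite limg_dim_eq ?dimvf // capfv; apply/eqP; rewrite -subv0.
  apply/subvP => w; rewrite memv_ker memv0 lfunE /= -mulmxA => /eqP.
  move/(congr1 (mulmx B)); rewrite mulKmx // mulmx0 frob_tangentE => /colP e.
  have := e 0; have := e 1; have := e 2; have := e 3; rewrite !mxE /=.
  move=> /eqP + /eqP + /eqP + /eqP; rewrite !mulf_eq0 !expf_eq0 q_gt0 /=.
  move: st0; rewrite xpair_eqE negb_and => /orP [] /negPf -> /=.
    by move=> _ _ /eqP w1 /eqP w0; apply/eqP/col2P; rewrite !mxE.
  by move=> /eqP w1 /eqP w0 _ _; apply/eqP/col2P; rewrite !mxE.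
split=> [/memv_imgP [w _ ->] | /(tangent_sub_frob st0) [w ->]].
  by rewrite lfunE /= -mulmxA; apply: frob_tangent_sub.
by rewrite mulmxA; apply/memv_imgP; exists w; rewrite ?memvf // lfunE.
Qed.

(** * Plane sections and the degree *)

(** The restriction of the linear form [u] to the curve, dehomogenized at [t = 1]. *)
Definition frob_poly (u : 'rV[k]_4) : {poly k} :=
  u 0 0 *: 'X^(q.+1) + (u 0 1 *: 'X^q + u 0 2 *: 'X + (u 0 3)%:P).

Lemma mulmx_frob_mono (u : 'rV[k]_4) (s : k) :
  (u *m frob_mono s 1) 0 0 = (frob_poly u).[s].
Proof.
by rewrite mxE sum_ord4 !mxE /= !expr1n !mulr1 /frob_poly !hornerE.
Qed.

Lemma size_frob_poly (u : 'rV[k]_4) : (0 < q)%N -> u 0 0 != 0 ->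
  size (frob_poly u) = q.+2.
Proof.
move=> q_gt0 u0; rewrite size_polyDl size_scale ?size_polyXn //.
have sz (f g : {poly k}) : (size f <= q.+1 -> size g <= q.+1 ->
    size (f + g)%R <= q.+1)%N.
  by move=> fq gq; rewrite (leq_trans (size_polyD _ _)) // geq_max fq.
rewrite ltnS; apply: (sz); last by rewrite (leq_trans (size_polyC_leq1 _)).
apply: sz; first by rewrite (leq_trans (size_scale_leq _ _)) ?size_polyXn.
by rewrite (leq_trans (size_scale_leq _ _)) // size_polyX.
Qed.

(* The derivative is [u_0 'X^q + u_2], so the combination
   [u_0 (g - 'X g') - u_1 g'] is the constant [u_0 u_3 - u_1 u_2]. *)
Lemma separable_frob_poly (u : 'rV[k]_4) :
  u 0 0 * u 0 3 - u 0 1 * u 0 2 != 0 -> separable_poly (frob_poly u).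
Proof.
move=> D0; have dXq : ('X^q : {poly k})^`() = 0 := deriv_exp_eq0 'X.
have dg : (frob_poly u)^`() = u 0 0 *: 'X^q + (u 0 2)%:P.
  rewrite /frob_poly !derivD !derivZ derivC derivX dXq exprS derivM derivX dXq.
  by rewrite mul1r mulr0 scaler0 !addr0 add0r alg_polyC.
rewrite unlock; apply/Bezout_coprimepP.
exists ((u 0 0)%:P, - (u 0 0)%:P * 'X - (u 0 1)%:P).
rewrite /= dg; apply/eqpP; exists (1, u 0 0 * u 0 3 - u 0 1 * u 0 2).
  by rewrite oner_eq0.
rewrite /= scale1r alg_polyC /frob_poly -!mul_polyC exprS rmorphB !rmorphM /=.
by ring.
Qed.

(** The polynomial excluding bad planes: its first factor keeps the point [t = 0] of the curve off
    the plane, the second makes the intersections simple. *)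
Definition frob_disc : {mpoly k[4]} :=
  lin_form A^T 0 *
  (lin_form A^T 0 * lin_form A^T 3 - lin_form A^T 1 * lin_form A^T 2).

Lemma meval_frob_disc (h : 'rV[k]_4) (u := h *m A) :
  meval_col frob_disc h^T = u 0 0 * (u 0 0 * u 0 3 - u 0 1 * u 0 2).
Proof.
rewrite /meval_col rmorphM rmorphB !rmorphM /= !meval_lin_form -trmx_mul.
by rewrite ![_^T _ _]mxE.
Qed.

(** A plane outside the zero locus of [frob_disc] meets the curve only at points [(s : 1)], one for
    each of the [q.+1] distinct roots of [frob_poly u]. *)
Lemma frob_curve_degree : (0 < q)%N -> curve_degree (frob_curve A) q.+1.
Proof.
move=> q_gt0; exists frob_disc.
  (* At the plane [h] with [h A = (1, 0, 0, 1)] the value of [frob_disc] is 1. *)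
  pose u : 'rV[k]_4 := \row_j [:: 1; 0; 0; 1]`_j.
  apply/eqP => /(congr1 (fun f => meval_col f (u *m B)^T)).
  rewrite meval_frob_disc mulmxKV // !mxE /meval_col rmorph0 /=.
  by move/eqP; rewrite mulr0 subr0 !mul1r oner_eq0.
move=> h; rewrite meval_frob_disc; set u := h *m A.
rewrite mulf_eq0 negb_or => /andP [u0 D0].
have hE s t : h *m (A *m frob_mono s t) = u *m frob_mono s t by rewrite mulmxA.
clearbody u.
have hE1 s : (h *m (A *m frob_mono s 1) == 0) = root (frob_poly u) s.
  rewrite hE rootE -mulmx_frob_mono; apply/eqP/eqP => [-> | e].
    by rewrite mxE.
  by apply/rowP => i; rewrite ord1 e mxE.
have nz s : A *m frob_mono s 1 != 0.
  have : frob_mono s 1 != 0 by rewrite frob_mono_eq0 xpair_eqE oner_eq0 andbF.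
  by apply: contraNneq => /(congr1 (mulmx B)); rewrite mulKmx // mulmx0 => ->.
pose pt s : P3 k := sval (hcoord_ex (nz s)).
have ptP s : hcoord (pt s) (A *m frob_mono s 1) := svalP (hcoord_ex (nz s)).
(* For [t = 1] the last two monomials are [s] and [1], so proportional vectors are related by the
   scalar 1. *)
have pt_inj : injective pt.
  move=> s s' ss'; have Ps := ptP s; rewrite ss' in Ps.
  have [c _ /(congr1 (mulmx B))] := hcoord_prop (ptP s') Ps.
  rewrite -scalemxAr !mulKmx // => /colP e.
  have := e 2; have := e 3; rewrite !mxE /= !expr1n !mulr1 => <-.
  by rewrite mul1r.
have [r rE] := closed_field_poly_normal (frob_poly u).
have lc0 : lead_coef (frob_poly u) != 0.
  by rewrite lead_coef_eq0 -size_poly_eq0 size_frob_poly.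
have r_root s : (s \in r) = root (frob_poly u) s.
  by rewrite rE rootZ // root_prod_XsubC.
exists (map pt r); split.
- rewrite map_inj_uniq // -separable_prod_XsubC.
  have := separable_frob_poly D0.
  by rewrite rE; apply: dvdp_separable; rewrite dvdpZr.
- have := size_frob_poly q_gt0 u0.
  by rewrite rE size_scale // size_prod_XsubC size_map => [[]].
move=> P; split=> [/mapP [s sr ->] | [CP [x Px hx]]].
  split; first by exists s, 1; rewrite xpair_eqE oner_eq0 andbF.
  by exists (A *m frob_mono s 1) => //; apply/eqP; rewrite hE1 -r_root.
have [s [t [st0 xE]]] := frob_curve_hcoord CP Px; rewrite {}xE in Px hx.
(* At [t = 0] the linear form takes the nonzero value [u_0 s^(q+1)]; otherwise the parameter is
   rescaled to [(s / t : 1)]. *)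
have [t0|t0] := eqVneq t 0.
  move: st0; rewrite t0 xpair_eqE eqxx andbT => s0; move: hx; rewrite t0 hE.
  move/rowP/(_ 0); rewrite mxE sum_ord4 !mxE /=.
  rewrite !exprS !(mul0r, mulr0) expr0n (gtn_eqF q_gt0) !mulr0 !addr0 -exprS.
  by move/eqP; rewrite mulf_eq0 expf_eq0 /= (negPf s0) orbF (negPf u0).
have sc : A *m frob_mono s t = t ^+ q.+1 *: (A *m frob_mono (s / t) 1).
  by rewrite scalemxAr -frob_mono_scale mulr1 mulrC divfK.
have t1 : t ^+ q.+1 != 0 by rewrite expf_neq0.
apply/mapP; exists (s / t).
  rewrite r_root -hE1; move/eqP: hx.
  by rewrite sc -scalemxAr scaler_eq0 (negPf t1).
apply: (hcoord_inj Px); rewrite sc; exact: hcoord_scale.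
Qed.

End FrobeniusCurve.

Lemma vanishing_form_ext (k : fieldType) (C D : P3 k -> Prop) f :
  (forall P, C P -> D P) -> vanishing_form D f -> vanishing_form C f.
Proof. by move=> CD [fh fD]; split=> // P x /CD; apply: fD. Qed.

(** Equivalent predicates have the same vanishing forms; this transports smoothness to [curveJ],
    which agrees with [frob_curve] pointwise. *)
Lemma smooth_curve_ext (k : fieldType) (C D : P3 k -> Prop) :
  (forall P, C P <-> D P) -> smooth_curve C -> smooth_curve D.
Proof.
move=> CD [clC smC]; split=> [P van | P x /CD CP Px].
  by apply/CD/clC => f x fC; apply: van; apply: vanishing_form_ext fC => Q /CD.
have [T dT TP] := smC P x CP Px; exists T => // v; rewrite TP.
by split=> tan f fV; apply: tan; apply: vanishing_form_ext fV => Q /CD.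
Qed.

(** * The curve on the Fermat surface *)

Definition FJ_index (q : nat) (i : 'I_4) : 'I_q.+2 :=
  inord (nth 0 [:: 0; 1; q; q.+1] i)%N.

(** The linear change of coordinates carrying the monomial curve to [curveJ]. *)
Definition AJ (k : fieldType) (q : nat) (omega xi eta : k) : 'M[k]_4 :=
  colsub (FJ_index q) (FJ q omega xi eta).

Section FermatCurve.

Variables (k : closedFieldType) (q : nat) (omega xi eta : k).
Hypothesis q_gt1 : (1 < q)%N.

Lemma val_FJ_index i : FJ_index q i = (nth 0 [:: 0; 1; q; q.+1] i)%N :> nat.
Proof.
by apply: inordK; case: i => [[|[|[|[]]]] //= _]; rewrite !ltnS.
Qed.

(** Since [1 < q], the indices 0, 1, [q], [q.+1] are distinct, so the nested tests of [FJ] reach all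
    four columns. *)
Lemma AJE i : [/\ AJ q omega xi eta i 0 =
      col4 (eta ^- q * xi ^+ q) 0 0 (omega * eta^-1 * xi) i 0,
    AJ q omega xi eta i 1 = col4 0 1 0 0 i 0,
    AJ q omega xi eta i 2 = col4 0 0 1 0 i 0
  & AJ q omega xi eta i 3 = col4 (- eta ^- q) 0 0 (omega * eta^-1) i 0].
Proof.
have := @val_FJ_index; rewrite /AJ => vE.
split; rewrite [LHS]mxE [LHS]mxE vE //=.
  by rewrite (gtn_eqF (ltnW q_gt1)) (gtn_eqF q_gt1) eqxx.
by rewrite eqSS (gtn_eqF (ltnW q_gt1)) (gtn_eqF (ltnSn q)) eqxx.
Qed.

(** All other columns of [FJ] vanish; the right factor selects the four monomials from the Veronese
    vector. *)
Lemma FJ_factor : FJ q omega xi eta =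
  AJ q omega xi eta *m rowsub (FJ_index q) 1%:M.
Proof.
apply/matrixP => i j; rewrite [RHS]mxE sum_ord4.
have [-> -> -> ->] := AJE i.
rewrite [FJ _ _ _ _ _ _]mxE ![rowsub _ _ _ _]mxE ![1%:M _ _]mxE.
rewrite -!val_eqE /= !val_FJ_index /= !(eq_sym _ (val j)) /=.
have q0 := ltnW q_gt1.
have [->|_] := eqVneq (val j) 0%N.
  by rewrite !(ltn_eqF q0) !mulr1 !mulr0 !addr0.
have [->|_] := eqVneq (val j) 1%N.
  by rewrite !(ltn_eqF q_gt1) !eqSS (ltn_eqF q0) !mulr1 !mulr0 !addr0 add0r.
have [->|_] := eqVneq (val j) q.
  by rewrite (ltn_eqF (leqnn q.+1)) !mulr1 !mulr0 !addr0 add0r.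
by case: eqP => _; rewrite !(mulr0, mulr1, add0r, addr0).
Qed.

Lemma paramJE s t :
  paramJ q omega xi eta s t = AJ q omega xi eta *m frob_mono q s t.
Proof.
apply: col4P; rewrite ![(_ *m _) _ _]mxE !sum_ord4.
have [-> -> -> ->] := AJE 0; have [-> -> -> ->] := AJE 1.
have [-> -> -> ->] := AJE 2; have [-> -> -> ->] := AJE 3.
by rewrite !mxE /=; split; ring.
Qed.

Lemma FJ_veronese s t :
  FJ q omega xi eta *m veronese q.+1 s t = paramJ q omega xi eta s t.
Proof.
rewrite FJ_factor paramJE -mulmxA mul_rowsub_mx mul1mx; congr (_ *m _).
apply: col4P; rewrite !mxE !val_FJ_index /=.
by rewrite subn0 subn1 subSnn subnn !expr0 !expr1 mulr1 mul1r.
Qed.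

Lemma curveJE P :
  curveJ q omega xi eta P <-> frob_curve q (AJ q omega xi eta) P.
Proof.
by split=> -[s [t [st0 Pst]]]; exists s, t; move: Pst; rewrite paramJE.
Qed.

Hypothesis omega_eq : omega ^+ q.+1 = -1.
Hypotheses (eta_eq : eta ^+ q.+1 = xi ^+ q + xi) (xi_eq0 : xi ^+ q + xi != 0).

Let omega_neq0 : omega != 0.
Proof.
apply: contra_eqN omega_eq => /eqP ->.
by rewrite expr0n eq_sym oppr_eq0 oner_eq0.
Qed.

Let eta_neq0 : eta != 0.
Proof. by apply: contraNneq xi_eq0 => e0; rewrite -eta_eq e0 expr0n. Qed.

(** The two middle coordinates are fixed, and the block on coordinates 0 and 3 has determinant
    [omega eta^(-q-1) (xi^q + xi)], which is nonzero. *)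
Lemma AJ_unit : AJ q omega xi eta \in unitmx.
Proof.
rewrite -row_free_unit; apply: inj_row_free => v /rowP vA.
have := vA 0; have := vA 1; have := vA 2; have := vA 3.
rewrite !mxE !sum_ord4.
have [-> -> -> ->] := AJE 0; have [-> -> -> ->] := AJE 1.
have [-> -> -> ->] := AJE 2; have [-> -> -> ->] := AJE 3.
rewrite !mxE /= !(mulr0, mulr1, add0r, addr0) => e3 e2 e1 e0.
have v0 : v 0 0 = 0.
  (* Subtracting [xi] times [e3] from [e0] eliminates [v 0 3]. *)
  apply/eqP; have : v 0 0 * (eta ^- q * (xi ^+ q + xi)) = 0.
    by rewrite -[RHS]e0 -[LHS]addr0 -{1}(mulr0 xi) -e3; ring.
  by move/eqP; rewrite !mulf_eq0 invr_eq0 expf_eq0 (negPf eta_neq0) andbF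
    (negPf xi_eq0) !orbF.
move: e3; rewrite v0 mul0r add0r => /eqP.
rewrite !mulf_eq0 invr_eq0 (negPf eta_neq0) (negPf omega_neq0) !orbF => /eqP v3.
by apply/trmx_inj/col4P; rewrite !mxE.
Qed.

(** The columns of the invertible [AJ] are among those of [FJ]. *)
Lemma rank_FJ : \rank (FJ q omega xi eta) = 4.
Proof.
apply/eqP; rewrite eqn_leq rank_leq_row /=.
rewrite -[X in (X <= _)%N](eqP (_ : row_free (AJ q omega xi eta))); last first.
  by rewrite row_free_unit AJ_unit.
rewrite /AJ -[FJ _ _ _ _ in X in (X <= _)%N]mulmx1 -mulmx_colsub.
by rewrite mxrankM_maxl.
Qed.

Hypothesis frobD : {morph (fun x : k => x ^+ q) : x y / x + y}.
Hypotheses (xi_Fq2 : in_Fq2 q xi) (eta_Fq2 : in_Fq2 q eta).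

(** Put [S = s^(q+1)] and [T = t^(q+1)]. As [xi] and [eta] are fixed by the [q^2]-power map, the
    outer coordinates contribute [((xi^q S - T)(xi S^q - T^q) - (xi S + T)(xi^q S^q + T^q)) /
    eta^(q+1)]. This equals [- (S T^q + S^q T)] and cancels the contribution of the middle ones. *)
Lemma paramJ_fermat s t (x := paramJ q omega xi eta s t) :
  x^T *m frob_mx q x = 0.
Proof.
have frobB (y z : k) : (y - z) ^+ q = y ^+ q - z ^+ q.
  by rewrite -[y in RHS](subrK z) [in RHS]frobD /= addrK.
have Fq2 (y : k) : in_Fq2 q y -> (y ^+ q) ^+ q = y.
  by rewrite -exprM mulnn.
apply/matrixP => i j; rewrite !ord1 mxE sum_ord4 {}/x !mxE /=.
rewrite frobB frobD /= !exprMn !exprVn (Fq2 _ xi_Fq2) (Fq2 _ eta_Fq2).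
rewrite !exprS !exprMn.
have omegaq : omega ^+ q = - omega^-1.
  by apply: (mulfI omega_neq0); rewrite -exprS omega_eq mulrN mulfV.
have etaq : eta ^+ q = (xi ^+ q + xi) / eta.
  by apply: (mulfI eta_neq0); rewrite -exprS eta_eq; field.
rewrite omegaq etaq; field.
by rewrite eta_neq0 omega_neq0 xi_eq0.
Qed.

End FermatCurve.

Theorem mainTheorem4 (p e q : nat) (Fq : finFieldType) (k : closedFieldType)
    (iota : {rmorphism Fq -> k}) (omega xi eta : k)
    (p_prime : prime p) (e_gt0 : (0 < e)%N) (q_def : q = (p ^ e)%N)
    (card_Fq : #|Fq| = q)
    (k_algebraic : forall x : k, algebraicOver iota x)
    (omega_Fq2 : in_Fq2 q omega) (xi_Fq2 : in_Fq2 q xi)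
    (eta_Fq2 : in_Fq2 q eta)
    (omega_eq : omega ^+ q.+1 = -1)
    (xi_eq : xi ^+ q.+1 = 1) (xi_neq : xi ^+ 2 != -1)
    (eta_eq : eta ^+ q.+1 = xi ^+ q + xi) :
  let C := curveJ q omega xi eta in
  let F := FJ q omega xi eta in
  [/\ (1 < \rank F)%N /\ (forall P : P3 k, C P <-> rational_curve F P),
      nonplanar F,
      curve_degree C q.+1,
      smooth_curve C
    & forall P : P3 k, C P -> fermat_surface q P].
Proof.
have charp : p \in [pchar k].
  apply: (rmorph_pchar iota).
  by apply: (@card_finPcharP _ p e); rewrite ?card_Fq.
have q_nat : [pchar k].-nat q.
  by rewrite (eq_pnat _ (pcharf_eq charp)) q_def pnatX pnat_id.
have q_eq0 : q%:R = 0 :> k.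
  by rewrite q_def natrX (pcharf0 charp) expr0n gtn_eqF.
have q_gt1 : (1 < q)%N.
  by rewrite q_def -(expn0 p) ltn_exp2l // prime_gt1.
have q_gt0 := ltnW q_gt1.
have frobD : {morph (fun x : k => x ^+ q) : x y / x + y}.
  by move=> x y; apply: exprDn_pchar.
(* This follows from [xi^2 + 1 = xi^2 + xi^(q+1) = xi (xi + xi^q)]. *)
have xi_eq0 : xi ^+ q + xi != 0.
  apply: contraNneq xi_neq => e0; rewrite -addr_eq0 addrC -xi_eq exprS expr2.
  by rewrite -mulrDr e0 mulr0.
have AU := AJ_unit q_gt1 omega_eq eta_eq xi_eq0.
have rF := rank_FJ q_gt1 omega_eq eta_eq xi_eq0.
move=> C F; have CE P : C P <-> frob_curve q (AJ q omega xi eta) P.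
  exact: curveJE.
split.
- rewrite /F rF; split=> // P.
  by split=> -[s [t [st0 Pst]]]; exists s, t; move: Pst; rewrite FJ_veronese.
- exact: rF.
- have [G G0 GP] := frob_curve_degree AU q_eq0 q_gt0; exists G => // h /GP.
  case=> S [uS sS SP]; exists S; split=> // P; rewrite SP.
  by split=> [[/CE]|[/CE]].
- apply: smooth_curve_ext (frob_curve_smooth AU q_eq0 q_gt0) => P.
  exact: iff_sym (CE P).
- move=> P [s [t [_ Pst]]]; exists (paramJ q omega xi eta s t) => //.
  exact: paramJ_fermat.
Qed.
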